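(* Let $b=4k+3$ for some integer $k>0$. Then every prime $n$ that is a pandigital number in base $b$ satisfies $$n\ge \frac{b^b-b^2+b-1}{(b-1)^2}+b^b+b^{b-2},$$ and every prime $n$ that is a penholodigital number in base $b$ satisfies $$n\ge \frac{b^b-b^2+b-1}{(b-1)^2}+b^{b-1}+b^{b-2}.$$
   Context: Numbers are written in base $b$ without leading zeros, with digits $0,1,\dots,b-1$. A positive integer $N$ is a pandigital number in base $b$ if its base-$b$ representation contains each of the $b$ digits $0,1,\dots,b-1$ at least once. $N$ is a penholodigital number in base $b$ if its base-$b$ representation does not contain the digit $0$ and contains each of the $b-1$ nonzero digits $1,\dots,b-1$ at least once. *)

(* Defs.v *)
From mathcomp Require Import all_boot.

Set Implicit Arguments.
Unset Strict Implicit.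
Unset Printing Implicit Defensive.

(* Base-b digits of n, least significant first, without leading zeros when
   1 < b and 0 < n (see digits_ltn, digits_sum and last_digits_neq0 below). *)
Definition digits (b n : nat) : seq nat :=
  mkseq (fun i => (n %/ b ^ i) %% b) (trunc_log b n).+1.

Definition pandigital (b n : nat) : Prop :=
  0 < n /\ (forall d, d < b -> d \in digits b n).

Definition penholodigital (b n : nat) : Prop :=
  [/\ 0 < n, 0 \notin digits b n
    & forall d, 0 < d -> d < b -> d \in digits b n].

Lemma digits_ltn b n : 1 < b -> all (fun d => d < b) (digits b n).
Proof.
move=> b_gt1; apply/allP => _ /mapP[i _ ->].
by rewrite ltn_mod ltnW.
Qed.

Lemma digits_sum b n : 1 < b ->
  n = \sum_(i < size (digits b n)) nth 0 (digits b n) i * b ^ i.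
Proof.
move=> b_gt1; rewrite size_mkseq.
under eq_bigr => i _ do rewrite nth_mkseq //.
have trunc m : \sum_(i < m) (n %/ b ^ i) %% b * b ^ i = n %% b ^ m.
  elim: m => [|m IHm]; first by rewrite big_ord0 modn1.
  rewrite big_ord_recr /= IHm.
  have bm_gt0 : 0 < b ^ m by rewrite expn_gt0 ltnW.
  rewrite [in RHS](divn_eq n (b ^ m)) [in RHS](divn_eq (n %/ b ^ m) b).
  rewrite mulnDl -mulnA -expnS -addnA modnMDl addnC [RHS]modn_small //.
  rewrite expnS; apply: (@leq_trans (((n %/ b ^ m) %% b).+1 * b ^ m)).
    by rewrite mulSn addnC ltn_add2r ltn_mod.
  by rewrite leq_pmul2r // ltn_mod ltnW.
by rewrite trunc modn_small // trunc_log_ltn.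
Qed.

Lemma last_digits_neq0 b n : 1 < b -> 0 < n -> last 0 (digits b n) != 0.
Proof.
move=> b_gt1 n_gt0.
have /andP[lo hi] := trunc_log_bounds b_gt1 n_gt0.
have bm_gt0 : 0 < b ^ trunc_log b n by rewrite expn_gt0 ltnW.
rewrite -nth_last size_mkseq nth_mkseq //= modn_small ?ltn_divLR -?expnS //.
by rewrite -lt0n divn_gt0.
Qed.

(* Main.v *)
(** Modulo [b - 1] a number is congruent to its digit sum.  For [b = 4k + 3] the
    digits [0, ..., b-1] sum to the odd number [(2k + 1) * b], so if [e] denotes
    the sum of the digits repeated beyond the required ones, a pandigital (or
    penholodigital) [n] satisfies [n = 2k + 1 + e] modulo [2 * (2k + 1)].  A prime
    [n] thus excludes [e = 0] (divisibility by [2k + 1]) and [e = 1] (parity).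
    Either at least two digits are repeated, and [n] is too long to be below the
    bound, or exactly one digit is, it is at least [2], and [n] is at least the
    number with digits [1, 0, 2, 2, 3, ..., b-1] (or [1, 2, 2, 3, ..., b-1]). *)

Require Import Defs.
From mathcomp Require Import all_boot all_order all_algebra.
From mathcomp Require Import zify ring.

Import Order.TTheory GRing.Theory Num.Theory.
Local Open Scope ring_scope.

(** * The least number with prescribed digits *)

Section DigitValue.

Local Open Scope nat_scope.

Variable b : nat.

Definition digit_value (s : seq nat) : nat :=
  \sum_(i < size s) nth 0 s i * b ^ i.

Lemma digit_value_rcons s x :
  digit_value (rcons s x) = digit_value s + x * b ^ size s.
Proof.
rewrite /digit_value size_rcons big_ord_recr /= nth_rcons ltnn eqxx.
by congr (_ + _); apply: eq_bigr => i _; rewrite nth_rcons ltn_ord.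
Qed.

Lemma digit_value_ltn s :
  all (fun d => d < b) s -> digit_value s < b ^ size s.
Proof.
elim/last_ind: s => [|s x IHs]; first by rewrite /digit_value big_ord0.
rewrite all_rcons digit_value_rcons size_rcons expnS => /andP[ltxb /IHs lts].
apply: (@leq_trans (x.+1 * b ^ size s)); last by rewrite leq_mul2r ltxb orbT.
by rewrite mulSn ltn_add2r.
Qed.

Lemma digit_value_mod s : 0 < b -> digit_value s = sumn s %[mod b.-1].
Proof.
move=> b_gt0; elim/last_ind: s => [|s x IHs].
  by rewrite /digit_value big_ord0.
rewrite digit_value_rcons sumn_rcons -modnDm IHs modnDm.
rewrite -modnDmr -modnMmr -modnXm -{1}(prednK b_gt0) -addn1 modnDl.
by rewrite modnXm exp1n modnMmr muln1 modnDmr.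
Qed.

(** The least significant digit comes first, so [rev (iota c j)] is the numeral c, c+1, ..., c+j-1
    read from the left, with leading digit c. *)
Lemma digit_value_ascendingS c j :
  digit_value (rev (iota c j.+1)) = digit_value (rev (iota c.+1 j)) + c * b ^ j.
Proof. by rewrite [iota _ _]/= rev_cons digit_value_rcons size_rev size_iota. Qed.

Lemma digit_value_ascending_ltn c j :
  c + j <= b -> digit_value (rev (iota c j)) < b ^ j.
Proof.
move=> le_cj; have := @digit_value_ltn (rev (iota c j)).
rewrite size_rev size_iota; apply.
by rewrite all_rev; apply/allP => d; rewrite mem_iota; lia.
Qed.

(** Ascending order from the left is the least arrangement: a larger leading digit adds a full place
    value, which exceeds the whole ascending tail. Leaving [d] free lets the lemma absorb an unknown
    repeated digit. *)
Lemma digit_value_perm_ge c j d s : c + j < b -> c <= d ->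
  perm_eq s (d :: iota c.+1 j) ->
  digit_value (rev (iota c j.+1)) <= digit_value s.
Proof.
elim: j c d s => [|j IHj] c d s lt_cj le_cd; elim/last_ind: s => [|s x _] ps.
- by have := perm_size ps.
- have /size0nil s0 : size s = 0 by have := perm_size ps; rewrite size_rcons => -[].
  move: ps; rewrite s0 => /perm_small_eq/= -> //.
  by rewrite /rev /digit_value /= !big_ord1 /= !expn0 !muln1.
- by have := perm_size ps.
have sz : size s = j.+1.
  by have := perm_size ps; rewrite size_rcons /= size_iota => -[].
rewrite digit_value_ascendingS digit_value_rcons sz.
have : x \in d :: iota c.+1 j.+1 by rewrite -(perm_mem ps) mem_rcons mem_head.
rewrite in_cons mem_iota => xP.
have [le_xc|lt_cx] := leqP x c.
  (* All digits but [d] exceed [c]. After removal of this leading digit, c+1 takes over the role of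
     [d]. *)
  have [xc dc] : x = c /\ d = c by lia.
  move: ps; rewrite xc dc perm_rcons perm_cons => ps.
  by rewrite leq_add2r; apply: (IHj c.+1 c.+1) => //; lia.
have lt_asc : digit_value (rev (iota c.+1 j.+1)) < b ^ j.+1.
  by apply: digit_value_ascending_ltn; lia.
nia.
Qed.

(** The bound is the numeral c, c, c+1, ..., c+j. Once a leading [c] is removed, [d] and c+1, ...,
    c+j remain, also when [d = c]. *)
Lemma digit_value_perm_ge_double c j d s : c + j < b -> c <= d ->
  perm_eq s (d :: iota c j.+1) ->
  digit_value (rev (iota c j.+1)) + c * b ^ j.+1 <= digit_value s.
Proof.
move=> lt_cj le_cd; elim/last_ind: s => [|s x _] ps; first by have := perm_size ps.
have sz : size s = j.+1.
  by have := perm_size ps; rewrite size_rcons /= size_iota => -[].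
rewrite digit_value_rcons sz.
have : x \in d :: iota c j.+1 by rewrite -(perm_mem ps) mem_rcons mem_head.
rewrite in_cons mem_iota => xP.
have [le_xc|lt_cx] := leqP x c.
  have xc : x = c by lia.
  rewrite xc leq_add2r (@digit_value_perm_ge _ _ d) //; apply/permP => a.
  by have := permP ps a; rewrite xc -cats1 count_cat /=; lia.
have lt_asc : digit_value (rev (iota c j.+1)) < b ^ j.+1.
  by apply: digit_value_ascending_ltn; lia.
nia.
Qed.

End DigitValue.

(** The last term accounts for raising every digit by c-1; it vanishes for [c = 1], but the
    induction shifts [c]. *)
Lemma digit_value_ascendingE (b c j : nat) :
  (b%:R - 1) ^+ 2 * (digit_value b (rev (iota c j)))%:R =
  b%:R ^+ j.+1 - j.+1%:R * b%:R + j%:R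
    + (c%:R - 1) * (b%:R - 1) * (b%:R ^+ j - 1) :> rat.
Proof.
elim: j c => [|j IHj] c; first by rewrite /digit_value big_ord0 /=; ring.
rewrite digit_value_ascendingS natrD mulrDr IHj natrM natrX !exprS -!natr1.
ring.
Qed.

(** * Repeated digits of a prime *)

Section Digits.

Local Open Scope nat_scope.

(** With the required digits as [t], this isolates in [u] those repeated beyond them. *)
Lemma perm_cat_uniq_sub (T : eqType) (s t : seq T) :
  uniq t -> {subset t <= s} -> exists u, perm_eq s (u ++ t).
Proof.
elim: t s => [|x t IHt] s /=; first by exists s; rewrite cats0.
case/andP=> xt ut sub; have xs : x \in s by apply: sub; rewrite mem_head.
have [y yt|u pu] := IHt (rem x s) ut.
  have : y \in s by apply: sub; rewrite in_cons yt orbT.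
  rewrite (perm_mem (perm_to_rem xs)) in_cons => /predU1P[yx|//].
  by rewrite -yx yt in xt.
exists u; rewrite (permPl (perm_to_rem xs)) perm_sym.
by rewrite (perm_catCA u [:: x] t) perm_cons perm_sym.
Qed.

Lemma digit_value_digits b n : 1 < b -> digit_value b (digits b n) = n.
Proof. by move=> b_gt1; rewrite [RHS](digits_sum n b_gt1). Qed.

Lemma leq_digits b n m :
  1 < b -> 0 < n -> m < size (digits b n) -> b ^ m <= n.
Proof.
move=> b_gt1 n_gt0; rewrite size_mkseq ltnS => le_m.
have /andP[le_n _] := trunc_log_bounds b_gt1 n_gt0.
by apply: leq_trans le_n; rewrite leq_pexp2l // ltnW.
Qed.

Lemma sumn_iota_double c j : (sumn (iota c j)).*2 + j = j * (c.*2 + j).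
Proof. elim: j c => [|j IHj] c //=; have := IHj c.+1; nia. Qed.

(** The pandigital case is [z = 0], the penholodigital one [z = 1]; the digit 0 does not affect the
    digit sum. *)
Lemma prime_repeated_digits_ge2 k b n z u : 0 < k -> b = 4 * k + 3 ->
  prime n -> z <= 1 -> perm_eq (digits b n) (u ++ iota z (b - z)) ->
  1 < sumn u.
Proof.
move=> k_gt0 def_b n_pr z_le1 pu; have b_gt1 : 1 < b by lia.
(* Hence [n] differs from both candidate divisors, 2k+1 and 2. *)
have lt_n : b <= n.
  rewrite -[b in b <= _]expn1; apply: leq_digits (prime_gt0 n_pr) _ => //.
  by rewrite (perm_size pu) size_cat size_iota; lia.
have sum_iota : sumn (iota z (b - z)) = (2 * k + 1) * b.
  have := sumn_iota_double z (b - z).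
  by case: z z_le1 {pu} => [|[|]] // _; nia.
have := digit_value_mod b (digits b n) (ltnW b_gt1).
rewrite digit_value_digits // (perm_sumn pu) sumn_cat sum_iota => n_mod.
have n_dvd m : m %| b.-1 -> m %| sumn u + (2 * k + 1) * b -> m = n \/ m = 1.
  move=> dvd_mb dvd_mu.
  have /eqP : n = sumn u + (2 * k + 1) * b %[mod m].
    by rewrite -(modn_dvdm n dvd_mb) n_mod modn_dvdm.
  rewrite (eqP dvd_mu) => /(primeP n_pr).2/pred2P[]; tauto.
rewrite ltnNge; apply/negP => sumn_le1.
have [u0|u1] : sumn u = 0 \/ sumn u = 1 by lia.
  have [|||] := n_dvd (2 * k + 1); try lia.
    by rewrite def_b; apply/dvdnP; exists 2; lia.
  by rewrite u0 add0n dvdn_mulr.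
by have [|||] := n_dvd 2; lia.
Qed.

Lemma pandigital_prime_ge k b n j : 0 < k -> b = 4 * k + 3 -> b = j.+3 ->
  prime n -> pandigital b n ->
  digit_value b (rev (iota 1 j.+2)) + b ^ j.+3 + b ^ j.+1 <= n.
Proof.
move=> k_gt0 def_b def_j n_pr [n_gt0 n_pan]; have b_gt1 : 1 < b by lia.
have lt_asc : digit_value b (rev (iota 2 j.+1)) < b ^ j.+1.
  by apply: digit_value_ascending_ltn; lia.
(* The bound is below b^(j+3) + 3 b^(j+1), hence below b^(j+3) + b^(j+2): it suffices to treat
   numbers of b+1 digits starting with 1, 0. *)
have expS3 m : 3 * b ^ m <= b ^ m.+1 by rewrite expnS leq_mul2r; lia.
have [[le_e2 le_e3] le_e4] := (expS3 j.+1, expS3 j.+2, expS3 j.+3).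
rewrite digit_value_ascendingS.
have [u pu] : exists u, perm_eq (digits b n) (u ++ iota 0 b).
  apply: perm_cat_uniq_sub (iota_uniq _ _) _ => d.
  by rewrite mem_iota => /n_pan.
have u_ge2 : 1 < sumn u.
  by apply: (prime_repeated_digits_ge2 k b n 0); rewrite ?subn0.
have : 1 < size u \/ exists d, u = [:: d].
  by case: (u) u_ge2 => [|d [|? ?]] // _; [right; exists d | left].
case=> [u_gt1|[d def_u]].
- have : b ^ j.+4 <= n.
    apply: leq_digits => //; rewrite (perm_size pu) size_cat size_iota def_j.
    by rewrite -[j.+4]add1n ltn_add2r.
  by nia.
move: pu u_ge2; rewrite {}def_u cat1s => pu d_ge2; rewrite /= addn0 in d_ge2.
have := last_digits_neq0 b_gt1 n_gt0.
rewrite -[n in _ <= n](digit_value_digits b n b_gt1).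
elim/last_ind: (digits b n) pu => [|s x _] ps; first by have := perm_size ps.
rewrite last_rcons.
elim/last_ind: s ps => [|r y _] ps x_neq0.
  by have := perm_size ps; rewrite /= size_iota def_j.
have sz : size r = j.+2.
  by have := perm_size ps; rewrite !size_rcons /= size_iota def_j => -[].
rewrite !digit_value_rcons size_rcons sz.
have [x1|x_neq1] := eqVneq x 1; last by nia.
have [y0|y_neq0] := eqVneq y 0; last by nia.
have pr : perm_eq r (d :: iota 2 j.+1).
  apply/permP => a; have := permP ps a.
  by rewrite def_j x1 y0 -!cats1 !count_cat /=; lia.
(* After 1, 0 the least tail is 2, 2, 3, ..., b-1, because the repeated digit is at least 2. *)
have := digit_value_perm_ge_double b 2 j d r _ d_ge2 pr.
rewrite x1 y0; lia.
Qed.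

Lemma penholodigital_prime_ge k b n j : 0 < k -> b = 4 * k + 3 -> b = j.+3 ->
  prime n -> penholodigital b n ->
  digit_value b (rev (iota 1 j.+2)) + b ^ j.+2 + b ^ j.+1 <= n.
Proof.
move=> k_gt0 def_b def_j n_pr [n_gt0 n_neq0 n_pan]; have b_gt1 : 1 < b by lia.
have lt_asc : digit_value b (rev (iota 2 j.+1)) < b ^ j.+1.
  by apply: digit_value_ascending_ltn; lia.
(* Here the bound is below b^(j+2) + 3 b^(j+1), hence below 2 b^(j+2), which leaves only numbers of
   b digits with leading digit 1. *)
have expS3 m : 3 * b ^ m <= b ^ m.+1 by rewrite expnS leq_mul2r; lia.
have [le_e2 le_e3] := (expS3 j.+1, expS3 j.+2).
rewrite digit_value_ascendingS.
have [u pu] : exists u, perm_eq (digits b n) (u ++ iota 1 (b - 1)).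
  apply: perm_cat_uniq_sub (iota_uniq _ _) _ => d.
  by rewrite mem_iota => /andP[d_gt0 d_lt]; apply: n_pan => //; lia.
have u_ge2 : 1 < sumn u by apply: (prime_repeated_digits_ge2 k b n 1).
have : 1 < size u \/ exists d, u = [:: d].
  by case: (u) u_ge2 => [|d [|? ?]] // _; [right; exists d | left].
case=> [u_gt1|[d def_u]].
- have : b ^ j.+3 <= n.
    apply: leq_digits => //; rewrite (perm_size pu) size_cat size_iota def_j.
    by rewrite -[j.+3]add1n subn1 ltn_add2r.
  by nia.
move: pu u_ge2; rewrite {}def_u cat1s => pu d_ge2; rewrite /= addn0 in d_ge2.
have : 0 \notin digits b n by [].
rewrite -[n in _ <= n](digit_value_digits b n b_gt1).
elim/last_ind: (digits b n) pu => [|r x _] ps; first by have := perm_size ps.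
rewrite mem_rcons in_cons negb_or eq_sym => /andP[x_neq0 _].
have sz : size r = j.+2.
  by have := perm_size ps; rewrite size_rcons /= size_iota def_j subn1 => -[].
rewrite digit_value_rcons sz.
have [x1|x_neq1] := eqVneq x 1; last by nia.
have pr : perm_eq r (d :: iota 2 j.+1).
  apply/permP => a; have := permP ps a.
  by rewrite def_j subn1 x1 -!cats1 !count_cat /=; lia.
have := digit_value_perm_ge_double b 2 j d r _ d_ge2 pr.
rewrite x1; lia.
Qed.

End Digits.

Theorem theorem6 (b k : nat) (hk : (0 < k)%N) (hb : b = (4 * k + 3)%N) :
  (forall n : nat, prime n -> pandigital b n ->
     (b%:R ^+ b - b%:R ^+ 2 + b%:R - 1) / (b%:R - 1) ^+ 2
       + b%:R ^+ b + b%:R ^+ (b - 2) <= n%:R :> rat)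
  /\
  (forall n : nat, prime n -> penholodigital b n ->
     (b%:R ^+ b - b%:R ^+ 2 + b%:R - 1) / (b%:R - 1) ^+ 2
       + b%:R ^+ (b - 1) + b%:R ^+ (b - 2) <= n%:R :> rat).
Proof.
have [j def_j] : exists j, b = j.+3 by exists (4 * k)%N; lia.
have b1_neq0 : b%:R - 1 != 0 :> rat.
  by rewrite subr_eq0 -[1]/(1%:R) eqr_nat def_j.
(* The fraction is the value of the numeral 1, 2, ..., b-1. *)
have -> : (b%:R ^+ b - b%:R ^+ 2 + b%:R - 1) / (b%:R - 1) ^+ 2 =
    (digit_value b (rev (iota 1 j.+2)))%:R :> rat.
  apply: (canLR (mulfK _)); first by rewrite expf_neq0.
  rewrite mulrC digit_value_ascendingE subrr !mul0r addr0 -def_j.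
  have -> : j.+2%:R = b%:R - 1 :> rat by rewrite def_j -[j.+3]addn1 natrD addrK.
  ring.
have [-> ->] : (b - 1 = j.+2 /\ b - 2 = j.+1)%N by lia.
split=> n n_pr n_pan; rewrite -!natrX -!natrD ler_nat.
  by rewrite {3}def_j (pandigital_prime_ge k).
by rewrite (penholodigital_prime_ge k).
Qed.
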